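(* Let $\mathbb{Q}(i)$ be the quadratic field, where $i^2=-1$. If $(b,c)\in\{(1,1),(1,2),(1,3),(2,2),(2,3),(2,4)\}$, then the quaternion algebra $\mathbb{H}_{\mathbb{Q}(i)}(-b,-c)$ over $\mathbb{Q}(i)$ is a split algebra. Moreover, $\mathbb{H}_{\mathbb{Q}(i)}(-2,-5)$ is a division algebra.
   Context: For a field $K$ of characteristic $0$ and positive integers $b,c$, $\mathbb{H}_{K}(-b,-c)$ is the 4-dimensional associative unital $K$-algebra with basis $\{1,e_2,e_3,e_4\}$ and $e_2^2=-b$, $e_3^2=-c$, $e_2e_3=-e_3e_2=e_4$. For $x=x_1+x_2e_2+x_3e_3+x_4e_4$ with $x_j\in K$ the norm is $\mathbf{n}(x)=x_1^2+bx_2^2+cx_3^2+bcx_4^2$. The algebra is called a division algebra if $\mathbf{n}(x)=0$ implies $x=0$; otherwise it is called a split algebra. *)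

(* Defs.v *)
From HB Require Import structures.
From mathcomp Require Import all_boot all_order all_algebra all_field.
From mathcomp Require Import ring.

Set Implicit Arguments.
Unset Strict Implicit.
Unset Printing Implicit Defensive.

Import GRing.Theory Num.Theory.
Local Open Scope ring_scope.

(* [quat K b c] is H_K(-b,-c); note the signs: e2 ^+ 2 = - b, e3 ^+ 2 = - c.  *)
(* The row vector x stands for x 0 0 + x 0 1 e2 + x 0 2 e3 + x 0 3 e4, so the *)
(* coordinates x_1, ..., x_4 are numbered from 0.                             *)
Definition quat (K : fieldType) (b c : nat) : Type := 'rV[K]_4.

HB.instance Definition _ (K : fieldType) (b c : nat) :=
  Vector.copy (quat K b c) 'rV[K]_4.

Section QuatAlgebra.

Variables (K : fieldType) (b c : nat).

Local Notation H := (quat K b c).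
Implicit Types x y z : H.

Definition qcoord x (k : 'I_4) : K := (x : 'rV[K]_4) 0 k.

Definition mkquat (x1 x2 x3 x4 : K) : H :=
  (\row_(k < 4) [:: x1; x2; x3; x4]`_k : 'rV[K]_4).

Definition qone : H := mkquat 1 0 0 0.
Definition e2 : H := mkquat 0 1 0 0.
Definition e3 : H := mkquat 0 0 1 0.
Definition e4 : H := mkquat 0 0 0 1.

(* The bilinear extension of the table generated by e2 e2 = - b, e3 e3 = - c  *)
(* and e2 e3 = - e3 e2 = e4.                                                  *)
Definition qmul x y : H :=
  let x1 := qcoord x 0 in let x2 := qcoord x 1 in
  let x3 := qcoord x 2 in let x4 := qcoord x 3 in
  let y1 := qcoord y 0 in let y2 := qcoord y 1 in
  let y3 := qcoord y 2 in let y4 := qcoord y 3 in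
  mkquat
    (x1 * y1 - b%:R * (x2 * y2) - c%:R * (x3 * y3) - b%:R * c%:R * (x4 * y4))
    (x1 * y2 + x2 * y1 + c%:R * (x3 * y4 - x4 * y3))
    (x1 * y3 + x3 * y1 - b%:R * (x2 * y4 - x4 * y2))
    (x1 * y4 + x4 * y1 + x2 * y3 - x3 * y2).

Lemma quatP x y :
  [/\ qcoord x 0 = qcoord y 0, qcoord x 1 = qcoord y 1,
      qcoord x 2 = qcoord y 2 & qcoord x 3 = qcoord y 3] -> x = y.
Proof.
case=> h0 h1 h2 h3; apply/rowP => -[[|[|[|[|//]]]] hk].
- by move: h0; rewrite /qcoord; congr (x _ _ = y _ _); apply: val_inj.
- by move: h1; rewrite /qcoord; congr (x _ _ = y _ _); apply: val_inj.
- by move: h2; rewrite /qcoord; congr (x _ _ = y _ _); apply: val_inj.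
- by move: h3; rewrite /qcoord; congr (x _ _ = y _ _); apply: val_inj.
Qed.

Lemma qcoord_mk (x1 x2 x3 x4 : K) :
  (qcoord (mkquat x1 x2 x3 x4) 0 = x1) * (qcoord (mkquat x1 x2 x3 x4) 1 = x2) *
  (qcoord (mkquat x1 x2 x3 x4) 2 = x3) * (qcoord (mkquat x1 x2 x3 x4) 3 = x4).
Proof. by rewrite /qcoord !mxE. Qed.

Lemma qcoordD x y k : qcoord (x + y) k = qcoord x k + qcoord y k.
Proof. exact: mxE. Qed.

Lemma qcoordZ (a : K) x k : qcoord (a *: x) k = a * qcoord x k.
Proof. exact: mxE. Qed.

Lemma qmulA : associative qmul.
Proof. by move=> x y z; apply: quatP; rewrite !qcoord_mk; split; ring. Qed.

Lemma qmul1q : left_id qone qmul.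
Proof. by move=> x; apply: quatP; rewrite !qcoord_mk; split; ring. Qed.

Lemma qmulq1 : right_id qone qmul.
Proof. by move=> x; apply: quatP; rewrite !qcoord_mk; split; ring. Qed.

Lemma qmulDl : left_distributive qmul +%R.
Proof.
by move=> x y z; apply: quatP; rewrite !qcoordD !qcoord_mk !qcoordD; split; ring.
Qed.

Lemma qmulDr : right_distributive qmul +%R.
Proof.
by move=> x y z; apply: quatP; rewrite !qcoordD !qcoord_mk !qcoordD; split; ring.
Qed.

Lemma qone_neq0 : qone != 0.
Proof.
apply/eqP => /(congr1 (qcoord^~ 0)); rewrite /= qcoord_mk /qcoord mxE.
by move/eqP; rewrite oner_eq0.
Qed.

HB.instance Definition _ := GRing.Zmodule_isNzRing.Build H
  qmulA qmul1q qmulq1 qmulDl qmulDr qone_neq0.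

Lemma qscalerAl (a : K) x y : a *: (x * y) = (a *: x) * y.
Proof.
by apply: quatP; rewrite qcoordZ !qcoord_mk !qcoordZ !qcoord_mk; split; ring.
Qed.

HB.instance Definition _ := GRing.Lmodule_isLalgebra.Build K H qscalerAl.

Lemma qscalerAr (a : K) x y : a *: (x * y) = x * (a *: y).
Proof.
by apply: quatP; rewrite qcoordZ !qcoord_mk !qcoordZ !qcoord_mk; split; ring.
Qed.

HB.instance Definition _ := GRing.Lalgebra_isAlgebra.Build K H qscalerAr.
HB.instance Definition _ := Algebra_isFalgebra.Build K H.

Lemma quatE x : x = (qcoord x 0)%:A + qcoord x 1 *: e2
                    + qcoord x 2 *: e3 + qcoord x 3 *: e4.
Proof.
by apply: quatP; rewrite !qcoordD !qcoordZ !qcoord_mk; split; ring.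
Qed.

Lemma quat_basis : basis_of {:H} [:: 1; e2; e3; e4].
Proof.
rewrite basisEdim dimvf /dim /= andbT; apply/subvP => x _.
rewrite [x]quatE.
by rewrite !memvD // memvZ // memv_span // !inE eqxx ?orbT.
Qed.

Lemma e2_sq : e2 ^+ 2 = - b%:R%:A.
Proof.
rewrite expr2 -scaleNr; apply: quatP.
by rewrite qcoordZ !qcoord_mk !qcoordZ !qcoord_mk; split; ring.
Qed.

Lemma e3_sq : e3 ^+ 2 = - c%:R%:A.
Proof.
rewrite expr2 -scaleNr; apply: quatP.
by rewrite qcoordZ !qcoord_mk !qcoordZ !qcoord_mk; split; ring.
Qed.

Lemma e2e3 : e2 * e3 = e4.
Proof. by apply: quatP; rewrite !qcoord_mk; split; ring. Qed.

Lemma e3e2 : e3 * e2 = - e4.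
Proof.
rewrite -[- e4]scaleN1r; apply: quatP.
by rewrite !qcoordZ !qcoord_mk; split; ring.
Qed.

Definition qnorm x : K :=
  qcoord x 0 ^+ 2 + b%:R * qcoord x 1 ^+ 2
  + c%:R * qcoord x 2 ^+ 2 + b%:R * c%:R * qcoord x 3 ^+ 2.

Definition division_quat : Prop := forall x, qnorm x = 0 -> x = 0.

Definition split_quat : Prop := ~ division_quat.

End QuatAlgebra.

Arguments e2 {K b c}.
Arguments e3 {K b c}.
Arguments e4 {K b c}.
Arguments division_quat K b c : clear implicits.
Arguments split_quat K b c : clear implicits.

(* K is the quadratic field Q(i), i a square root of -1, up to isomorphism.   *)
Definition is_gaussian_field (K : fieldExtType rat) (i : K) : Prop :=
  i ^+ 2 = -1 /\ <<1; i>>%VS = fullv.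

Lemma gaussian_field_exists :
  exists (K : fieldExtType rat) (i : K), is_gaussian_field i.
Proof.
have [K [KC [[|i [|//]] //= [Di] genK]]] := num_field_exists [:: 'i%R].
exists K, i; split; last by rewrite -genK adjoin_seq1.
by apply: (fmorph_inj KC); rewrite rmorphXn rmorphN1 /= Di sqrCi.
Qed.

(* Main.v *)
Require Import Defs.
From HB Require Import structures.
From mathcomp Require Import all_boot all_order all_algebra all_field.
From mathcomp Require Import ring zify.

(** Split cases: the norm of H(-b,-c) is x1^2 + b x2^2 + c x3^2 + bc x4^2, and
    since -1 = i^2 the vector (1, i, 0, 0) is isotropic for b = 1,
    (0, 1, i, 0) for b = c, (1, 1, i, 0) for c = b + 1, and (2i, 0, 1, 0) for
    c = 4.

    Division case: in Z[i] the rational prime 5 is pi * pi' with pi = 2 + i and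
    pi' = 2 - i, so the norm form for (2, 5) is
      (x1^2 + 2 x2^2) + pi pi' (x3^2 + 2 x4^2).
    The residue field at pi is F_5, where -2 is not a square; hence
    x^2 + 2 y^2 is anisotropic there, and pi' is a unit there.  As in
    Springer's theorem on quadratic forms over a complete discretely valued
    field, both residue forms being anisotropic forces the whole form to be
    anisotropic: reducing modulo pi shows that x1 and x2 are divisible by pi,
    dividing the equation by pi exchanges the roles of the two halves, so x3
    and x4 are divisible by pi too, and so on indefinitely ([springer]).  A
    Gaussian integer divisible by all powers of pi is 0 because its norm is
    then divisible by all powers of 5 ([gpi_separated]).  Finally, the four
    coordinates of an isotropic vector over Q(i) can be multiplied by a common
    denominator, which reduces the problem to Z[i] ([gemb_common_denom]). *)

Set Implicit Arguments.
Unset Strict Implicit.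
Unset Printing Implicit Defensive.

Import GRing.Theory Num.Theory.
Local Open Scope ring_scope.

Section Springer.

(** The pair ([rho], [p]) stands for a discrete valuation ring with its residue
    map and uniformizer; [p_sep] says that the p-adic topology is
    separated. *)
Variables (A : comNzRingType) (F : fieldType) (rho : {rmorphism A -> F}).
Variables (p d : A).
Hypothesis p_reg : GRing.lreg p.
Hypothesis ker_rho : forall z, rho z = 0 -> exists w, z = p * w.
Hypothesis rho_p : rho p = 0.
Hypothesis p_sep : forall z, (forall n, exists w, z = p ^+ n * w) -> z = 0.
Hypothesis aniso :
  forall x y : F, x ^+ 2 + rho d * y ^+ 2 = 0 -> x = 0 /\ y = 0.

(** The new equation has the shape of the old one, with the two halves and
    their coefficients [u] and [v] exchanged: the factor p^2 coming out of
    x1 and x2 leaves one p on their half and removes the p of the other. *)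
Lemma springer_half_step (u v x1 x2 x3 x4 : A) : rho u != 0 ->
    u * (x1 ^+ 2 + d * x2 ^+ 2) + p * v * (x3 ^+ 2 + d * x4 ^+ 2) = 0 ->
  exists y1 y2, [/\ x1 = p * y1, x2 = p * y2 &
    v * (x3 ^+ 2 + d * x4 ^+ 2) + p * u * (y1 ^+ 2 + d * y2 ^+ 2) = 0].
Proof.
move=> u_unit eq0.
have: rho x1 ^+ 2 + rho d * rho x2 ^+ 2 = 0.
  apply: (mulfI u_unit); rewrite mulr0 -!(rmorphXn, rmorphM, rmorphD) /=.
  have := congr1 rho eq0; rewrite rmorph0 rmorphD !rmorphM rho_p !mul0r addr0 /=.
  by rewrite -rmorphM.
case/aniso=> /ker_rho[y1 Dx1] /ker_rho[y2 Dx2]; exists y1, y2; split=> //.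
apply: p_reg; rewrite mulr0 -eq0 Dx1 Dx2; ring.
Qed.

(** Two half steps divide all four unknowns by [p] and give back an equation
    with the same coefficients, so the unknowns are divisible by every power
    of [p]. *)
Lemma springer (u v x1 x2 x3 x4 : A) : rho u != 0 -> rho v != 0 ->
    u * (x1 ^+ 2 + d * x2 ^+ 2) + p * v * (x3 ^+ 2 + d * x4 ^+ 2) = 0 ->
  [/\ x1 = 0, x2 = 0, x3 = 0 & x4 = 0].
Proof.
move=> u_unit v_unit eq0.
suffices dvd n: [/\ exists w, x1 = p ^+ n * w, exists w, x2 = p ^+ n * w,
    exists w, x3 = p ^+ n * w & exists w, x4 = p ^+ n * w].
  by split; apply: p_sep => n; case: (dvd n).
elim: n x1 x2 x3 x4 eq0 => [|n IHn] z1 z2 z3 z4 eq0.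
  by split; [exists z1 | exists z2 | exists z3 | exists z4]; rewrite mul1r.
have [y1 [y2 [-> -> eq1]]] := springer_half_step u_unit eq0.
have [y3 [y4 [-> -> eq2]]] := springer_half_step v_unit eq1.
have [[w1 ->] [w2 ->] [w3 ->] [w4 ->]] := IHn _ _ _ _ eq2.
by split; [exists w1 | exists w2 | exists w3 | exists w4]; rewrite exprS mulrA.
Qed.

End Springer.

(** The Gaussian integers, (a, b) standing for a + b i.  The alias keeps the
    ring structure apart from the componentwise one on pairs. *)
Definition gint : Type := (int * int)%type.
HB.instance Definition _ := GRing.Zmodule.copy gint (int * int)%type.

Definition gint_mul (z w : gint) : gint :=
  (z.1 * w.1 - z.2 * w.2, z.1 * w.2 + z.2 * w.1).

Lemma gint_eq (z w : gint) : z.1 = w.1 -> z.2 = w.2 -> z = w.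
Proof. by case: z w => [a b] [c d] /= -> ->. Qed.

Lemma gint_mulA : associative gint_mul.
Proof. by move=> x y z; apply: gint_eq => /=; ring. Qed.

Lemma gint_mulC : commutative gint_mul.
Proof. by move=> x y; apply: gint_eq => /=; ring. Qed.

Lemma gint_mul1 : left_id ((1, 0) : gint) gint_mul.
Proof. by move=> x; apply: gint_eq => /=; ring. Qed.

Lemma gint_mulDl : left_distributive gint_mul +%R.
Proof. by move=> x y z; apply: gint_eq => /=; ring. Qed.

HB.instance Definition _ := GRing.Zmodule_isComNzRing.Build gint
  gint_mulA gint_mulC gint_mul1 gint_mulDl isT.

Definition gnorm (z : gint) : int := z.1 ^+ 2 + z.2 ^+ 2.

Lemma gnormM z w : gnorm (z * w) = gnorm z * gnorm w.
Proof. rewrite /gnorm /=; ring. Qed.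

Lemma gnormX z n : gnorm (z ^+ n) = gnorm z ^+ n.
Proof. by elim: n => // n IHn; rewrite !exprS gnormM IHn. Qed.

Lemma gnorm_eq0 z : gnorm z = 0 -> z = 0.
Proof. by rewrite /gnorm => N0; apply: gint_eq => /=; nia. Qed.

(** The prime 2 + i, of norm 5. *)
Definition gpi : gint := (2, 1).

Lemma gpi_reg : GRing.lreg gpi.
Proof. by move=> z w [eq1 eq2]; apply: gint_eq; lia. Qed.

(** If pi^n divides z then 5^n divides the norm of z; taking n to be that norm
    itself already rules out a nonzero norm, as 5^n > n. *)
Lemma gpi_separated z : (forall n, exists w, z = gpi ^+ n * w) -> z = 0.
Proof.
move=> dvd_z; apply: gnorm_eq0; apply/eqP; rewrite -absz_eq0.
have [w Dz] := dvd_z `|gnorm z|%N; apply: contraT; rewrite -lt0n => N_gt0.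
have: (5 ^ `|gnorm z| %| `|gnorm z|)%N.
  by rewrite {2}Dz gnormM gnormX abszM abszX dvdn_mulr.
by move/(dvdn_leq N_gt0); rewrite leqNgt ltn_expl.
Qed.

(** Reduction modulo 2 + i, which sends i to -2. *)
Definition gres (z : gint) : 'F_5 := z.1%:~R - 2%:R * z.2%:~R.

Lemma gres_zmod : zmod_morphism gres.
Proof. by move=> z w; rewrite /gres /= !rmorphB /=; ring. Qed.

Lemma gres_monoid : monoid_morphism gres.
Proof.
split=> [|z w]; first by rewrite /gres /= mulr0 subr0.
apply/eqP; rewrite -subr_eq0 /gres /= rmorphB rmorphD !rmorphM /=.
set a := z.1%:~R; set b := z.2%:~R; set c := w.1%:~R; set e := w.2%:~R.
rewrite [X in X == _](_ : _ = - (5%:R * (b * e))); last by ring.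
(* The defect is a multiple of 5 because (-2)^2 = -1 modulo 5. *)
by rewrite (_ : 5%:R = 0) ?mul0r ?oppr0 //; apply: val_inj.
Qed.

HB.instance Definition _ := GRing.isZmodMorphism.Build gint 'F_5 gres gres_zmod.
HB.instance Definition _ :=
  GRing.isMonoidMorphism.Build gint 'F_5 gres gres_monoid.

Lemma gres_ker z : gres z = 0 -> exists w, z = gpi * w.
Proof.
have -> : gres z = (z.1 - 2 * z.2)%:~R by rewrite rmorphB rmorphM.
move/eqP; rewrite -(dvdz_pcharf (pchar_Fp (isT : prime 5))) => /dvdzP[m Dm].
(* With a = 2 b + 5 m one has a + b i = (2 + i) b + (2 + i) (2 - i) m. *)
by exists (z.2 + 2 * m, - m); apply: gint_eq => /=; lia.
Qed.

(** The arithmetic reason why (2, 5) gives a division algebra: -2 is not a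
    square modulo 5.  With 25 cases, enumeration settles it. *)
Lemma sq2_anisotropic_F5 (x y : 'F_5) :
  x ^+ 2 + gres 2%:R * y ^+ 2 = 0 -> x = 0 /\ y = 0.
Proof.
rewrite rmorph_nat.
case: x y => [[|[|[|[|[|//]]]]] hx] [[|[|[|[|[|//]]]]] hy] /(congr1 val) //= _.
by split; apply: val_inj.
Qed.

Section Embedding.
Variables (K : fieldExtType rat) (i : K).

(** The proof that i^2 = -1 is an argument so that the ring morphism
    structure declared below can be inferred from the term alone. *)
Definition gemb of i ^+ 2 = -1 := fun z : gint => z.1%:~R + z.2%:~R * i.

Hypothesis i2 : i ^+ 2 = -1.

Local Notation phi := (gemb i2).

Lemma gemb_zmod : zmod_morphism phi.
Proof. by move=> z w; rewrite /gemb /= !rmorphB /=; ring. Qed.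

Lemma gemb_monoid : monoid_morphism phi.
Proof.
split=> [|z w]; first by rewrite /gemb mul0r addr0.
by rewrite /gemb /= rmorphB rmorphD !rmorphM /=; ring: i2.
Qed.

HB.instance Definition _ := GRing.isZmodMorphism.Build gint K phi gemb_zmod.
HB.instance Definition _ := GRing.isMonoidMorphism.Build gint K phi gemb_monoid.

Lemma intr_eq0_alg (n : int) : n%:~R = 0 :> K -> n = 0.
Proof.
rewrite -(rmorph_int (in_alg K)) => /eqP.
by rewrite fmorph_eq0 intr_eq0 => /eqP.
Qed.

(** Multiplying by the conjugate reduces injectivity to the vanishing of the
    norm, an integer. *)
Lemma gemb_eq0 z : phi z = 0 -> z = 0.
Proof.
move=> z0; apply: gnorm_eq0; apply: intr_eq0_alg.
have: phi z * phi (z.1, - z.2) = 0 by rewrite z0 mul0r.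
rewrite /gemb /gnorm /= => <-; rewrite rmorphD !rmorphXn rmorphN /=; ring: i2.
Qed.

(** An element of Q(i) is a polynomial in i with rational coefficients; a
    denominator is built up along Horner's scheme. *)
Lemma gemb_frac (x : K) : x \in <<1; i>>%VS ->
  exists z, exists2 n : nat, n != 0%N & n%:R * x = phi z.
Proof.
case/Fadjoin_polyP=> _ /polyOver1P[q ->] ->.
elim/poly_ind: q => [|q c [z [n n_neq0 Dz]]].
  by exists 0, 1%N; rewrite // rmorph0 horner0 mulr0 rmorph0.
have c_frac: (`|denq c|%N%:R * c%:A : K) = (numq c)%:~R.
  rewrite -(rmorph_nat (in_alg K)) -(rmorph_int (in_alg K)) -rmorphM /=.
  by rewrite numqE mulrC pmulrn gez0_abs ?denq_ge0.
exists (z * (0, 1) * `|denq c|%N%:R + n%:R * (numq c)%:~R), (n * `|denq c|)%N.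
  by rewrite muln_eq0 negb_or n_neq0 absz_eq0 denq_neq0.
rewrite [RHS]rmorphD !(rmorphM phi) !(rmorph_nat phi) (rmorph_int phi) /=.
rewrite -Dz -c_frac.
rewrite [phi (0, 1)](_ : _ = i); last by rewrite /gemb mul1r add0r.
rewrite rmorphD rmorphM /= map_polyX map_polyC hornerE hornerMX hornerC /=.
ring.
Qed.

Lemma gemb_common_denom m (x : 'I_m -> K) : (forall k, x k \in <<1; i>>%VS) ->
  exists2 n : nat, n != 0%N & exists z, forall k, n%:R * x k = phi (z k).
Proof.
move=> ix; have [z] := fin_all_exists (fun k => gemb_frac (ix k)).
case/fin_all_exists2=> n n_neq0 Dz.
exists (\prod_k n k)%N; first by rewrite -lt0n prodn_gt0 // => k; rewrite lt0n.
exists (fun k => (\prod_(j | j != k) n j)%N%:R * z k) => k.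
rewrite (rmorphM phi) (rmorph_nat phi) /= -Dz (bigD1 k) //= natrM; ring.
Qed.

End Embedding.

Theorem proposition3p7 (K : fieldExtType rat) (i : K)
    (hK : is_gaussian_field i) :
  (forall b c : nat,
     (b, c) \in [:: (1, 1); (1, 2); (1, 3); (2, 2); (2, 3); (2, 4)]%N ->
     split_quat K b c)
  /\ division_quat K 2 5.
Proof.
case: hK => i2 K_i; split=> [b c | x x0].
  have isotropic_split (b' c' : nat) (x1 x2 x3 x4 : K) :
      [|| x1 != 0, x2 != 0 | x3 != 0] ->
      x1 ^+ 2 + b'%:R * x2 ^+ 2 + c'%:R * x3 ^+ 2
        + b'%:R * c'%:R * x4 ^+ 2 = 0 -> split_quat K b' c'.
    move=> nz x0 /(_ (mkquat b' c' x1 x2 x3 x4)).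
    rewrite /qnorm !qcoord_mk => /(_ x0) mk0.
    have q0 k: qcoord (0 : quat K b' c') k = 0 by rewrite /qcoord mxE.
    move: nz; have := qcoord_mk b' c' x1 x2 x3 x4.
    by rewrite mk0 !q0 => -[[[<- <-] <-] _]; rewrite eqxx.
  rewrite !inE => /or4P[|||/or3P[]] /eqP[-> ->].
  - by apply: (isotropic_split _ _ 1 i 0 0); rewrite ?oner_neq0 //; ring: i2.
  - by apply: (isotropic_split _ _ 1 i 0 0); rewrite ?oner_neq0 //; ring: i2.
  - by apply: (isotropic_split _ _ 1 i 0 0); rewrite ?oner_neq0 //; ring: i2.
  - apply: (isotropic_split _ _ 0 1 i 0); first by rewrite oner_neq0 orbT.
    by ring: i2.
  - by apply: (isotropic_split _ _ 1 1 i 0); rewrite ?oner_neq0 //; ring: i2.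
  - apply: (isotropic_split _ _ (2%:R * i) 0 1 0); last by ring: i2.
    by rewrite oner_neq0 !orbT.
have [k|n n_neq0 [z Dz]] := gemb_common_denom i2 (x := qcoord x).
  by rewrite K_i memvf.
have n_unit : n%:R != 0 :> K.
  by rewrite -(rmorph_nat (in_alg K)) fmorph_eq0 pnatr_eq0.
(* The norm of n x, with 5 written as (2 + i) (2 - i): [springer] applies with
   u = 1 and v = 2 - i, whose residue is 2 + 2 = -1 modulo 5. *)
pose f := 1 * (z 0 ^+ 2 + 2%:R * z 1 ^+ 2)
  + gpi * ((2, -1) : gint) * (z 2 ^+ 2 + 2%:R * z 3 ^+ 2).
have f0 : f = 0.
  have gpi_conj : gpi * ((2, -1) : gint) = 5%:R by apply: gint_eq.
  apply: (gemb_eq0 (i2 := i2)); rewrite /f gpi_conj.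
  rewrite !(rmorphD, rmorphM, rmorphXn, rmorph_nat, rmorph1) /= -!Dz.
  transitivity (n%:R ^+ 2 * qnorm x); last by rewrite x0 mulr0.
  rewrite /qnorm; ring.
have gres_gpi : gres gpi = 0 by apply: val_inj.
have gres1 : gres 1 != 0 by [].
have gres_gpi' : gres (2, -1) != 0 by [].
have [z0 z1 z2 z3] :=
  springer gpi_reg gres_ker gres_gpi gpi_separated sq2_anisotropic_F5
    gres1 gres_gpi' f0.
have coord0 k : z k = 0 -> qcoord x k = 0.
  by move=> zk; apply: (mulfI n_unit); rewrite Dz zk rmorph0 mulr0.
have q0 k: qcoord (0 : quat K 2 5) k = 0 by rewrite /qcoord mxE.
by apply: quatP; rewrite !q0 !coord0.
Qed.
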